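(* Let $f:\{-1,1\}^n\to\{-1,1\}$ be low-correlation self-predicting, and let $n_f=|\{i\in[n]:\hat f_{\{i\}}\neq0\}|$, assumed $\ge1$. Then $f$ is $\sqrt{\frac{2}{\pi n_f}}$-close to a linear threshold function, i.e., there is a linear threshold function $g$ with $\Pr(f(X^n)\ne g(X^n))\le\sqrt{2/(\pi n_f)}$, $X^n$ uniform on $\{-1,1\}^n$.
   Context: $\hat f_S=\mathbb{E}[f(X^n)\prod_{i\in S}X_i]$. A linear threshold function is $g(x^n)=\operatorname{sgn}(a_0+\sum_{i=1}^n a_ix_i)$ with real coefficients chosen so that $a_0+\sum_i a_ix_i\neq0$ for all $x^n\in\{-1,1\}^n$. For $\rho\in[0,1]$, $T_\rho f(y^n)=\sum_{S\subseteq[n]}\rho^{|S|}\hat f_S\prod_{i\in S}y_i$; $\operatorname{sgn}(0)=0$; $f$ is $\rho$-SP if $f(y^n)=\operatorname{sgn}T_\rho f(y^n)$ whenever $T_\rho f(y^n)\ne0$; $f$ is low-correlation self-predicting if there is $\rho^*>0$ with $f$ $\rho$-SP for all $\rho\in[0,\rho^* )$. *)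

(* Defs.v *)
From HB Require Import structures.
From mathcomp Require Import all_boot all_order all_algebra.
From mathcomp Require Import reals trigo.

Set Implicit Arguments.
Unset Strict Implicit.
Unset Printing Implicit Defensive.

Import Order.TTheory GRing.Theory Num.Theory.

Local Open Scope ring_scope.

(* Elements of {-1,1} are encoded by booleans: b stands for (-1) ^+ b, that is,
   false for 1 and true for -1. *)
Definition cube (n : nat) := {ffun 'I_n -> bool}.

Definition spin (R : realType) (b : bool) : R := (-1) ^+ b.
Arguments spin R b : clear implicits.

Definition expect (R : realType) (n : nat) (F : cube n -> R) : R :=
  (\sum_(x : cube n) F x) / #|{: cube n}|%:R.

Definition prob (R : realType) (n : nat) (A : pred (cube n)) : R :=
  #|A|%:R / #|{: cube n}|%:R.
Arguments prob R {n} A.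

Definition chi (R : realType) (n : nat) (S : {set 'I_n}) (x : cube n) : R :=
  \prod_(i in S) spin R (x i).
Arguments chi R {n} S x.

Definition fourier (R : realType) (n : nat) (f : cube n -> bool)
    (S : {set 'I_n}) : R :=
  expect (fun x => spin R (f x) * chi R S x).
Arguments fourier R {n} f S.

Definition noise_op (R : realType) (n : nat) (rho : R) (f : cube n -> bool)
    (y : cube n) : R :=
  \sum_(S : {set 'I_n}) rho ^+ #|S| * fourier R f S * chi R S y.

Definition self_predicting (R : realType) (n : nat) (rho : R)
    (f : cube n -> bool) : Prop :=
  forall y : cube n, noise_op rho f y != 0 ->
    spin R (f y) = Num.sg (noise_op rho f y).

(* noise_op is only meaningful for rho in [0, 1], hence the bound rho <= 1. *)
Definition low_corr_self_predicting (R : realType) (n : nat)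
    (f : cube n -> bool) : Prop :=
  exists rhos : R, 0 < rhos /\
    forall rho : R, 0 <= rho <= 1 -> rho < rhos -> self_predicting rho f.
Arguments low_corr_self_predicting R {n} f.

Definition affine_form (R : realType) (n : nat) (a0 : R) (a : 'I_n -> R)
    (x : cube n) : R :=
  a0 + \sum_(i < n) a i * spin R (x i).

Definition linear_threshold (R : realType) (n : nat) (g : cube n -> bool)
    : Prop :=
  exists (a0 : R) (a : 'I_n -> R),
    (forall x, affine_form a0 a x != 0) /\
    (forall x, spin R (g x) = Num.sg (affine_form a0 a x)).
Arguments linear_threshold R {n} g.

Definition nlin (R : realType) (n : nat) (f : cube n -> bool) : nat :=
  #|[set i : 'I_n | fourier R f [set i] != 0]|.
Arguments nlin R {n} f.

(* Main.v *)
Require Import Defs.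
From mathcomp Require Import all_boot all_order all_algebra.
From mathcomp Require Import reals trigo.
From mathcomp Require Import polyrcf ring lra.

Set Implicit Arguments.
Unset Strict Implicit.
Unset Printing Implicit Defensive.

Import Order.TTheory GRing.Theory Num.Theory.

Local Open Scope ring_scope.

(** The noise operator at y is a polynomial in rho, whose constant coefficient
    is E[f] and whose linear coefficient is the degree-1 part L of f at y.
    Self-prediction as rho tends to 0+ says that f(y) is the sign of this
    polynomial to the right of 0.  If E[f] were nonzero, f would be constant and
    have no degree-1 coefficient; so E[f] = 0, and f = sgn L off the zeros of L.
    For small e > 0 the thresholds sgn (L + e) and sgn (L - e) disagree exactly
    on the zeros of L, so one of them differs from f on at most half of these.

    To bound P(L = 0), correlate sgn L with the sum D of the sgn(a_i) x_i over
    the m coordinates with a_i != 0.  Along an edge in direction i, sgn L moves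
    monotonically in sgn(a_i) x_i, by at least 1 for each endpoint where L = 0,
    so m P(L = 0) <= E[sgn L * D] <= sqrt (E[D^2]) = sqrt m.  Finally
    1 / (2 sqrt m) <= sqrt (2 / (pi m)) because pi <= 8. *)

Lemma natr_card (R : pzSemiRingType) (T : finType) (A : {pred T}) :
  #|A|%:R = \sum_x (x \in A)%:R :> R.
Proof. by rewrite -natr_sum -sum1_card big_mkcond. Qed.

Section RealSigns.
Variable R : realFieldType.
Implicit Types u v w : R.

Lemma sgrD_norm_lt u v : `|v| < `|u| -> Num.sg (u + v) = Num.sg u.
Proof.
rewrite ltr_norml; case: (sgrP u) => u0 /andP[lbv ubv].
- by lra.
- by apply: gtr0_sg; lra.
- by apply: ltr0_sg; lra.
Qed.

Lemma zeros_le_sgr_jump u w : u != w ->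
  (u == 0)%:R + (w == 0)%:R <= Num.sg (u - w) * (Num.sg u - Num.sg w).
Proof.
rewrite -subr_eq0; case: (sgrP (u - w)) => // uw _;
  by case: (sgrP u) => u_sign; case: (sgrP w) => w_sign /=; lra.
Qed.

Lemma exists_lt_norm_neq0 (T : finType) (F : T -> R) :
  exists2 e, 0 < e & forall x, F x != 0 -> e < `|F x|.
Proof.
pose m := \big[Num.min/1]_(x | F x != 0) `|F x|.
have m_gt0 : 0 < m by apply: lt_bigmin => // x; rewrite normr_gt0.
exists (m / 2) => [|x Fx0]; first lra.
have : m <= `|F x| by apply: bigmin_le_cond.
lra.
Qed.

End RealSigns.

Lemma sgr_horner_right (R : rcfType) (p : {poly R}) (x b : R) :
  x < b -> p != 0 -> exists2 y, x < y < b & Num.sg p.[y] = sgp_right p x.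
Proof.
move=> ltxb p0; have [y yp] := neighpr_wit ltxb p0.
exists y; last exact: sgr_neighpr yp.
move: yp; rewrite /neighpr in_itv /= => /andP[-> /lt_le_trans->//].
have := next_root_in p x b; rewrite in_itv /= => /andP[_].
by rewrite (max_l (ltW ltxb)).
Qed.

Lemma inv_double_sqrt_le_sqrt_pi (R : realType) (m : R) : 0 <= m ->
  (2 * Num.sqrt m)^-1 <= Num.sqrt (2 / (pi * m)).
Proof.
move=> m_ge0; have pi_pos := pi_gt0 R.
have pi_lt4 : pi < 4 :> R by have := pihalf_lt2 R; lra.
have /ger0_norm <- : 0 <= (2 * Num.sqrt m)^-1.
  by rewrite invr_ge0 mulr_ge0 ?sqrtr_ge0.
rewrite -sqrtr_sqr ler_wsqrtr // exprVn exprMn sqr_sqrtr //.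
rewrite !invfM mulrA ler_wpM2r ?invr_ge0 // ler_pdivlMr //.
lra.
Qed.

Section Expectation.
Variables (R : realType) (n : nat).
Implicit Types (F G : cube n -> R) (c : R).

Lemma card_cube_gt0 : 0 < #|{: cube n}|%:R :> R.
Proof. by rewrite ltr0n; apply/card_gt0P; exists [ffun=> false]. Qed.

Lemma eq_expect F G : F =1 G -> expect F = expect G.
Proof. by move=> FG; rewrite /expect (eq_bigr _ (fun x _ => FG x)). Qed.

Lemma expectD F G : expect (fun x => F x + G x) = expect F + expect G.
Proof. by rewrite /expect big_split mulrDl. Qed.

Lemma expectZ c F : expect (fun x => c * F x) = c * expect F.
Proof. by rewrite /expect -mulr_sumr mulrA. Qed.

Lemma expect_sum (I : finType) (F : I -> cube n -> R) :
  expect (fun x => \sum_i F i x) = \sum_i expect (F i).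
Proof. by rewrite /expect exchange_big mulr_suml. Qed.

Lemma expect_cst c : expect (fun _ : cube n => c) = c.
Proof.
by rewrite /expect sumr_const -[c *+ _]mulr_natr mulfK ?gt_eqF ?card_cube_gt0.
Qed.

Lemma ler_expect F G : (forall x, F x <= G x) -> expect F <= expect G.
Proof.
by move=> FG; rewrite ler_pM2r ?invr_gt0 ?card_cube_gt0 // ler_sum.
Qed.

Lemma prob_expect (A : pred (cube n)) : prob R A = expect (fun x => (A x)%:R).
Proof. by rewrite /prob natr_card. Qed.

Lemma expect_sqr_le F : expect F ^+ 2 <= expect (fun x => F x ^+ 2).
Proof.
pose c := expect F.
have var_ge0 : expect (fun _ : cube n => 0) <= expect (fun x => (F x - c) ^+ 2).
  by apply: ler_expect => x; apply: sqr_ge0.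
have varE x : (F x - c) ^+ 2 = F x ^+ 2 + (- 2 * c * F x + c ^+ 2) by ring.
move: var_ge0; rewrite expect_cst (eq_expect varE) !expectD expectZ expect_cst.
by rewrite -/c; lra.
Qed.

Lemma expect_sgr_mul_le_sqrt F G :
  expect (fun x => Num.sg (F x) * G x) <= Num.sqrt (expect (fun x => G x ^+ 2)).
Proof.
apply: le_trans (ler_norm _) _; rewrite -sqrtr_sqr; apply: ler_wsqrtr.
apply: le_trans (expect_sqr_le _) _; apply: ler_expect => x.
by rewrite exprMn sqr_sg ler_piMl ?sqr_ge0 ?lern1 ?leq_b1.
Qed.

End Expectation.

Section Flip.
Variables (R : realType) (n : nat).
Implicit Types (i j : 'I_n) (x : cube n) (F : cube n -> R).

Lemma sgr_spin (b : bool) : Num.sg (spin R b) = spin R b.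
Proof. by rewrite /spin sgrX sgrN1. Qed.

Definition flip i x : cube n := [ffun j => x j (+) (j == i)].

Lemma flipK i : involutive (flip i).
Proof. by move=> x; apply/ffunP=> j; rewrite !ffunE -addbA addbb addbF. Qed.

Lemma spin_flip i x : spin R (flip i x i) = - spin R (x i).
Proof. by rewrite ffunE eqxx addbT /spin signrN. Qed.

Lemma spin_flip_neq i j x : j != i -> spin R (flip i x j) = spin R (x j).
Proof. by move=> /negbTE ji; rewrite ffunE ji addbF. Qed.

Lemma expect_flip i F : expect (fun x => F (flip i x)) = expect F.
Proof. by rewrite /expect [in RHS](reindex_inj (can_inj (flipK i))). Qed.

Lemma expect_mul_spin i F :
  expect (fun x => F x * spin R (x i)) =
  expect (fun x => (F x - F (flip i x)) * spin R (x i)) / 2.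
Proof.
have diffE x : (F x - F (flip i x)) * spin R (x i) =
    F x * spin R (x i) + F (flip i x) * spin R (flip i x i).
  by rewrite spin_flip; ring.
rewrite (eq_expect diffE) expectD (expect_flip i (fun x => F x * spin R (x i))).
by field.
Qed.

Lemma expect_spin i : expect (fun x => spin R (x i)) = 0.
Proof.
have := expect_mul_spin i (fun=> 1).
under eq_expect do rewrite mul1r; move=> ->.
by under eq_expect do rewrite subrr mul0r; rewrite expect_cst mul0r.
Qed.

End Flip.

Section AffineForms.
Variables (R : realType) (n : nat).
Implicit Types (i : 'I_n) (x : cube n) (a : 'I_n -> R) (G : cube n -> R).

Lemma affine_form_flip (a0 : R) a i x :
  affine_form a0 a (flip i x) = affine_form a0 a x - 2 * (a i * spin R (x i)).
Proof.
rewrite /affine_form (bigD1 i) //= [in RHS](bigD1 i) //= spin_flip.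
under eq_bigr => j ji do rewrite spin_flip_neq //.
ring.
Qed.

Lemma expect_mul_affine_form G (a0 : R) a :
  expect (fun x => G x * affine_form a0 a x) =
  a0 * expect G + \sum_i a i * expect (fun x => G x * spin R (x i)).
Proof.
under [in RHS]eq_bigr do rewrite -expectZ.
rewrite -expectZ -expect_sum -expectD; apply: eq_expect => x.
rewrite mulrDr mulrC mulr_sumr; congr (_ + _).
by apply: eq_bigr => i _; rewrite mulrCA.
Qed.

Lemma expect_affine_form (a0 : R) a : expect (affine_form a0 a) = a0.
Proof.
have := expect_mul_affine_form (fun=> 1) a0 a.
under eq_expect do rewrite mul1r; move=> ->.
rewrite expect_cst mulr1 big1 ?addr0 // => i _.
by under eq_expect do rewrite mul1r; rewrite expect_spin mulr0.
Qed.

Lemma expect_affine_form_spin (a0 : R) a i :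
  expect (fun x => affine_form a0 a x * spin R (x i)) = a i.
Proof.
have diffE x : (affine_form a0 a x - affine_form a0 a (flip i x)) *
    spin R (x i) = 2 * a i.
  rewrite affine_form_flip opprB addrC subrK.
  by rewrite -!mulrA -expr2 sqrr_sign mulr1.
by rewrite expect_mul_spin (eq_expect diffE) expect_cst; field.
Qed.

Lemma expect_affine_form_sqr (a0 : R) a :
  expect (fun x => affine_form a0 a x ^+ 2) = a0 ^+ 2 + \sum_i a i ^+ 2.
Proof.
under eq_expect do rewrite expr2.
rewrite expect_mul_affine_form expect_affine_form.
by under eq_bigr do rewrite expect_affine_form_spin -expr2.
Qed.

Lemma prob_affine_form_eq0_le_influence (a0 : R) a i : a i != 0 ->
  prob R [pred x | affine_form a0 a x == 0] <=
  Num.sg (a i) * expect (fun x => Num.sg (affine_form a0 a x) * spin R (x i)).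
Proof.
move=> ai0; set L := affine_form a0 a.
rewrite expect_mul_spin mulrA -expectZ ler_pdivlMr // prob_expect mulr_natr.
rewrite mulr2n -[X in _ + X](expect_flip i) -expectD; apply: ler_expect => x /=.
have jump : L x - L (flip i x) = 2 * (a i * spin R (x i)).
  by rewrite /L affine_form_flip; ring.
have edge : L x != L (flip i x).
  by rewrite -subr_eq0 jump !mulf_neq0 ?signr_eq0 ?pnatr_eq0.
apply: le_trans (zeros_le_sgr_jump edge) _.
rewrite jump !sgrM (gtr0_sg (ltr0Sn _ _)) mul1r sgr_spin.
by rewrite -mulrA [X in _ * X]mulrC.
Qed.

Lemma prob_affine_form_eq0_le (a0 : R) a :
  (0 < #|[set i | a i != 0%R]|)%N ->
  prob R [pred x | affine_form a0 a x == 0] <=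
  (Num.sqrt #|[set i | a i != 0]|%:R)^-1.
Proof.
set m := #|_| => m_gt0; set A := prob _ _; set L := affine_form a0 a.
pose D := affine_form 0 (fun i => Num.sg (a i)).
have mE : m%:R = \sum_i (a i != 0)%:R :> R.
  by rewrite natr_card; apply: eq_bigr => i _; rewrite inE.
have lower : A * m%:R <= expect (fun x => Num.sg (L x) * D x).
  rewrite expect_mul_affine_form mul0r add0r mE mulr_sumr.
  apply: ler_sum => i _; have [->|ai0] := eqVneq (a i) 0.
    by rewrite mulr0 sgr0 mul0r.
  by rewrite mulr1 prob_affine_form_eq0_le_influence.
have upper : expect (fun x => Num.sg (L x) * D x) <= Num.sqrt m%:R.
  apply: le_trans (expect_sgr_mul_le_sqrt _ _) _.
  rewrite expect_affine_form_sqr expr0n add0r mE.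
  by under eq_bigr do rewrite sqr_sg.
have sqrtm_gt0 : 0 < Num.sqrt m%:R :> R by rewrite sqrtr_gt0 ltr0n.
rewrite -div1r ler_pdivlMr // -(ler_pM2r sqrtm_gt0) mul1r -mulrA -expr2.
by rewrite sqr_sqrtr ?ler0n // (le_trans lower).
Qed.

Lemma linear_threshold_affine_form (a0 : R) a :
  (forall x, affine_form a0 a x != 0) ->
  linear_threshold R (fun x => affine_form a0 a x < 0).
Proof. by move=> L0; exists a0, a; split=> // x; apply: neqr0_sign. Qed.

Lemma exists_tie_breaking_thresholds (a0 : R) a :
  exists g : bool -> cube n -> bool,
    (forall b, linear_threshold R (g b)) /\
    (forall b x, g b x = if affine_form a0 a x == 0 then b
                         else affine_form a0 a x < 0).
Proof.
set L := affine_form a0 a.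
have [e e_gt0 e_lt] := exists_lt_norm_neq0 L.
pose L' b := affine_form (a0 + spin R b * e) a.
have sgL' b x : Num.sg (L' b x) = if L x == 0 then spin R b else Num.sg (L x).
  have -> : L' b x = L x + spin R b * e by rewrite /L' /affine_form addrAC.
  have [->|Lx0] := eqVneq (L x) 0.
    by rewrite add0r sgrM sgr_spin gtr0_sg ?mulr1.
  by rewrite sgrD_norm_lt // normrM normr_sign mul1r gtr0_norm ?e_lt.
exists (fun b x => L' b x < 0); split=> b => [|x].
  apply: linear_threshold_affine_form => x; rewrite -sgr_eq0 sgL'.
  by case: ifPn; rewrite ?signr_eq0 ?sgr_eq0.
by rewrite -sgr_lt0 sgL'; case: ifP; rewrite ?signr_lt0 ?sgr_lt0.
Qed.

Lemma exists_threshold_near_sgr (a0 : R) a (f : cube n -> bool) :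
  (forall x, affine_form a0 a x != 0 ->
     spin R (f x) = Num.sg (affine_form a0 a x)) ->
  exists g, linear_threshold R g /\
    prob R [pred x | f x != g x] <=
    prob R [pred x | affine_form a0 a x == 0] / 2.
Proof.
move=> fL; have [g [ltg gE]] := exists_tie_breaking_thresholds a0 a.
suff split_zeros : prob R [pred x | f x != g true x] +
    prob R [pred x | f x != g false x] =
    prob R [pred x | affine_form a0 a x == 0].
  have [le_tf|lt_ft] := leP (prob R [pred x | f x != g true x])
                            (prob R [pred x | f x != g false x]).
    by exists (g true); split=> //; lra.
  by exists (g false); split=> //; lra.
rewrite !prob_expect -expectD; apply: eq_expect => x /=; rewrite !gE.
case: ifPn => [_|L0]; first by case: (f x); rewrite ?addr0 ?add0r.
have -> : f x = (affine_form a0 a x < 0) by rewrite -sgr_lt0 -fL // signr_lt0.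
by rewrite eqxx addr0.
Qed.

End AffineForms.

Section NoisePolynomial.
Variables (R : realType) (n : nat) (f : cube n -> bool).
Implicit Types (y : cube n) (rho : R).

Definition linear_part : cube n -> R :=
  affine_form 0 (fun i => fourier R f [set i]).

Definition noise_poly y : {poly R} :=
  \sum_(S : {set 'I_n}) (fourier R f S * chi R S y) *: 'X^#|S|.

Lemma horner_noise_poly y rho : (noise_poly y).[rho] = noise_op rho f y.
Proof.
rewrite horner_sum; apply: eq_bigr => S _.
by rewrite hornerZ hornerXn mulrC mulrA.
Qed.

Lemma coef_noise_poly y k :
  (noise_poly y)`_k =
  \sum_(S : {set 'I_n} | #|S| == k) fourier R f S * chi R S y.
Proof.
rewrite coef_sum [RHS]big_mkcond; apply: eq_bigr => S _.
by rewrite coefZ coefXn eq_sym; case: eqP; rewrite ?mulr1 ?mulr0.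
Qed.

Lemma coef0_noise_poly y : (noise_poly y)`_0 = fourier R f set0.
Proof.
rewrite coef_noise_poly (big_pred1 set0) => [|S]; last by rewrite cards_eq0.
by rewrite /chi big_set0 mulr1.
Qed.

Lemma coef1_noise_poly y : (noise_poly y)`_1 = linear_part y.
Proof.
rewrite coef_noise_poly /linear_part /affine_form add0r.
rewrite (eq_bigl (mem [set [set i] | i : 'I_n])) => [|S]; last first.
  by apply/cards1P/imsetP => [[i ->]|[i _ ->]]; exists i.
rewrite big_imset /=; last by move=> i j _ _; apply: set1_inj.
by apply: eq_bigr => i _; rewrite /chi big_set1.
Qed.

Hypothesis f_sp : low_corr_self_predicting R f.

Lemma low_corr_sgp_right y :
  noise_poly y != 0 -> spin R (f y) = sgp_right (noise_poly y) 0.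
Proof.
move=> p0; have [rhos [rhos_gt0 sp]] := f_sp.
have min_gt0 : 0 < Num.min rhos 1 by rewrite lt_min rhos_gt0 ltr01.
have [rho /andP[rho_gt0]] := sgr_horner_right min_gt0 p0.
rewrite lt_min horner_noise_poly => /andP[rho_lt /ltW rho_le1] sg_noise.
rewrite -sg_noise; apply: sp => //; first by rewrite ltW.
by rewrite -sgr_eq0 sg_noise sgp_right_eq0.
Qed.

Lemma low_corr_fourier0 : (0 < nlin R f)%N -> fourier R f set0 = 0.
Proof.
case/card_gt0P=> i; rewrite inE; apply: contra_neq_eq => f0.
have f_cst y : spin R (f y) = Num.sg (fourier R f set0).
  rewrite -(coef0_noise_poly y) -horner_coef0 -sgp_rightNroot.
    apply: low_corr_sgp_right; apply: contra_neq f0 => p0.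
    by rewrite -(coef0_noise_poly y) p0 coef0.
  by rewrite rootE horner_coef0 coef0_noise_poly.
rewrite /fourier; under eq_expect do rewrite f_cst /chi big_set1.
by rewrite expectZ expect_spin mulr0.
Qed.

Lemma low_corr_sgr_linear_part y : fourier R f set0 = 0 ->
  linear_part y != 0 -> spin R (f y) = Num.sg (linear_part y).
Proof.
move=> f0 L0; have p0 : noise_poly y != 0.
  by apply: contra_neq L0; rewrite -coef1_noise_poly => ->; rewrite coef0.
have root0 : root (noise_poly y) 0.
  by rewrite rootE horner_coef0 coef0_noise_poly f0.
have deriv0 : (noise_poly y)^`().[0] = linear_part y.
  by rewrite horner_coef0 coef_deriv coef1_noise_poly.
rewrite low_corr_sgp_right // sgp_right_deriv //.
by rewrite sgp_rightNroot ?deriv0 // rootE deriv0.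
Qed.

End NoisePolynomial.

Theorem theorem5p10 (R : realType) (n : nat) (f : cube n -> bool)
    (hf : low_corr_self_predicting R f) (hn : (1 <= nlin R f)%N) :
  exists g : cube n -> bool,
    linear_threshold R g /\
    prob R [pred x | f x != g x] <= Num.sqrt (2 / (pi * (nlin R f)%:R)).
Proof.
have f0 := low_corr_fourier0 hf hn.
have [g [ltg g_near]] :=
  exists_threshold_near_sgr (fun x => @low_corr_sgr_linear_part _ _ _ hf x f0).
exists g; split=> //; apply: le_trans g_near _.
apply: le_trans (inv_double_sqrt_le_sqrt_pi _); last exact: ler0n.
rewrite invfM mulrC ler_pM2l ?invr_gt0 //.
exact: prob_affine_form_eq0_le hn.
Qed.
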